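(* Let $\bar A$, $\bar u$, $u_\delta$, the functions $x_k$ satisfying conditions A)–D), the matrices $\tilde A_h$, the number $\mu_\delta$ and the function $\beta_\delta$ be as defined in the context. Suppose that there is a constant $\delta_0>0$ such that $\|u_\delta\|>\mu_\delta$ for every $\delta$ with $0<\delta<\delta_0$, and let $h(\delta)>0$ be a generalized solution of the equation $\beta_\delta^2(h)=\delta^2+\mu_\delta^2$. Let $r(\delta)$ be the rank of the matrix $\tilde A_{h(\delta)}$. Suppose that for each $k$, $1\le k\le\bar r$, the relation $x_k(h)\sim1+a_kh$ holds as $h\to+0$, with $a_1<a_2<\dots<a_{\bar r}$. Then, as $\delta\to0$, $$\nu_s(\tilde A_{h(\delta)})\sim\frac{\bar\rho_1}{\bar\rho_{r(\delta)}}\bigl(1-h(\delta)(a_{r(\delta)}-a_1)\bigr)<\nu_s(\bar A).$$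
   Context: Let $m,n$ be positive integers and $M=\min(m,n)$. All vectors are real and carry the Euclidean norm; matrices carry the Euclidean (Frobenius) norm. $A^+$ denotes the Moore–Penrose pseudoinverse. The spectral condition number of a nonzero matrix $A$ of rank $r$ with singular values $\rho_1\ge\rho_2\ge\dots$ is $\nu_s(A)=\rho_1/\rho_r$. The symbol $\sim$ denotes asymptotic equivalence in the indicated limit. $\bar A$ is a fixed real $m\times n$ matrix with $\|\bar A\|\ne0$, and $\bar u\in\mathbb R^m$ is a fixed exact right-hand side with $\|\bar u\|\neq 0$. For each $\delta>0$, $u_\delta\in\mathbb R^m$ is an approximate right-hand side with $\|u_\delta-\bar u\|\le\delta$; only $\delta$ small enough that $\|u_\delta\|\ne0$ are considered. Let $\bar A=U\bar RV^T$ be a singular value decomposition, with $U$ ($m\times m$) and $V$ ($n\times n$) orthogonal and $\bar R$ the $m\times n$ diagonal matrix $\bar R=\mathrm{diag}[\bar\rho_1,\dots,\bar\rho_{\bar r},0,\dots,0]$, $\bar\rho_k\ge\bar\rho_{k+1}\geq 0$, where $\bar r=\mathrm{rank}\,\bar A\le M$. Put $\theta(\rho)=\rho^{-1}$ for $\rho>0$ and $\theta(0)=0$. Fix a constant $H>0$ and functions $x_k:[0,H]\to[0,\infty)$, $k=1,\dots,M$, such that for all $k$: A) for every $0<h\le H$, either $x_k(h)=0$ or $1<x_k(h)\le c_k$, where $c_k$ is a constant; B) $x_k(+0)=x_k(0)=1$ (where $x_k(+0)$ is the right limit at $0$) and $x_k(H)=0$; C) $x_k$ is left continuous at every $h\in(0,H]$;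 D) the function $h\mapsto\theta[x_k(h)]$ is non-increasing on $[0,H]$. For $0\le h\le H$ put $\tilde A_h=U\tilde R_hV^T$, where $\tilde R_h=\mathrm{diag}[\bar\rho_1x_1(h),\dots,\bar\rho_{\bar r}x_{\bar r}(h),0,\dots,0]$ is $m\times n$. Put $\beta_\delta(h)=\|\bar A\tilde A_h^+u_\delta-u_\delta\|$ for $0\le h\le H$, and $\mu_\delta=\|\bar A\bar A^+u_\delta-u_\delta\|$ (so $\beta_\delta(0)=\mu_\delta$). A generalized solution of the equation $\beta_\delta^2(h)=\delta^2+\mu_\delta^2$ is a point $h(\delta)$ such that $\liminf_{h\to h(\delta)}\beta_\delta^2(h)=\beta_\delta^2(h(\delta)-0)\le\mu_\delta^2+\delta^2\le\beta_\delta^2(h(\delta)+0)=\limsup_{h\to h(\delta)}\beta_\delta^2(h)$, the limits being taken over $h$ in the domain $[0,H]$.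
   Formalization: The condition ‖u_δ‖>μ_δ is required of every vector within δ of ū (for one chosen family the claim fails if ū is orthogonal to the range of Ā), and the strict inequality is claimed only for rank Ā ≥ 2 (for rank 1 both sides equal 1). *)

(* Defs.v *)
From HB Require Import structures.
From mathcomp Require Export all_boot all_order all_algebra.
From mathcomp Require Export all_classical all_reals all_analysis.

Set Implicit Arguments.
Unset Strict Implicit.
Unset Printing Implicit Defensive.

Export Order.TTheory GRing.Theory Num.Theory.
Export numFieldNormedType.Exports.

Local Open Scope classical_set_scope.
Local Open Scope ring_scope.

(* The families rho, s and x are indexed by natural numbers starting from 1;
   their values at index 0 play no role. *)

(* The library norm `|A| of a matrix is the sup norm. *)
Definition fnorm (R : realType) (m n : nat) (A : 'M[R]_(m, n)) : R :=
  Num.sqrt (\sum_i \sum_j A i j ^+ 2).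

Definition orthogonal (R : realType) (n : nat) (U : 'M[R]_n) : Prop :=
  U *m U^T = 1%:M /\ U^T *m U = 1%:M.

(* The m x n matrix diag[d 1, ..., d r, 0, ..., 0]. *)
Definition rdiag (R : realType) (m n r : nat) (d : nat -> R) : 'M[R]_(m, n) :=
  \matrix_(i < m, j < n)
    (if ((i : nat) == j) && (i < r)%N then d i.+1 else 0).

(* A = U diag[s 1, ..., s (rank A), 0, ..., 0] V^T is a singular value
   decomposition. *)
Definition is_svd (R : realType) (m n : nat) (A : 'M[R]_(m, n))
    (U : 'M[R]_m) (V : 'M[R]_n) (s : nat -> R) : Prop :=
  [/\ orthogonal U, orthogonal V,
      (forall k, (1 <= k)%N -> (k <= \rank A)%N -> 0 <= s k),
      (forall k, (1 <= k)%N -> (k < \rank A)%N -> s k.+1 <= s k) &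
      A = U *m rdiag m n (\rank A) s *m V^T].

(* singvals A k is the k-th largest singular value, for 1 <= k <= rank A. *)
Definition singvals (R : realType) (m n : nat) (A : 'M[R]_(m, n)) : nat -> R :=
  xget (fun=> 0) [set s | exists U V, is_svd A U V s].

(* Meaningful for A != 0 only. *)
Definition nu_s (R : realType) (m n : nat) (A : 'M[R]_(m, n)) : R :=
  singvals A 1%N / singvals A (\rank A).

Definition is_pseudoinverse (R : realType) (m n : nat)
    (A : 'M[R]_(m, n)) (X : 'M[R]_(n, m)) : Prop :=
  [/\ A *m X *m A = A, X *m A *m X = X,
      (A *m X)^T = A *m X & (X *m A)^T = X *m A].

(* The Penrose conditions have exactly one solution.  The library's pinvmx is
   only a generalized inverse. *)
Definition mp_inv (R : realType) (m n : nat) (A : 'M[R]_(m, n)) : 'M[R]_(n, m) :=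
  xget 0 [set X | is_pseudoinverse A X].

Definition theta (R : realType) (rho : R) : R := if 0 < rho then rho^-1 else 0.

Definition admissible_family (R : realType) (M : nat) (H : R)
    (x : nat -> R -> R) : Prop :=
  forall k, (1 <= k)%N -> (k <= M)%N ->
  [/\ (forall h, 0 <= h -> h <= H -> 0 <= x k h),
      (exists c : R, forall h, 0 < h -> h <= H ->
         x k h = 0 \/ (1 < x k h /\ x k h <= c)),
      [/\ x k h @[h --> 0^'+] --> (1 : R), x k 0 = 1 & x k H = 0],
      (forall h, 0 < h -> h <= H -> x k t @[t --> h^'-] --> x k h) &
      (forall h h', 0 <= h -> h <= h' -> h' <= H ->
         theta (x k h') <= theta (x k h))].

Definition Atilde (R : realType) (m n : nat) (r : nat)
    (U : 'M[R]_m) (V : 'M[R]_n) (rho : nat -> R) (x : nat -> R -> R)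
    (h : R) : 'M[R]_(m, n) :=
  U *m rdiag m n r (fun k => rho k * x k h) *m V^T.

(* The norm ||A B^+ u - u||: it is beta_delta(h) for B = Atilde ... h and
   mu_delta for B = A. *)
Definition residual (R : realType) (m n : nat) (A B : 'M[R]_(m, n))
    (u : 'cV[R]_m) : R :=
  fnorm (A *m mp_inv B *m u - u).

(* h0 in [0, H] is a generalized solution of f h = c:
     liminf_(h -> h0) f = f (h0 - 0) <= c <= f (h0 + 0) = limsup_(h -> h0) f,
   all limits being taken over h in [0, H] different from h0.  At an endpoint
   one of the two one-sided limits is over the empty set; the corresponding
   convergence is then void and the value is the liminf or limsup. *)
Definition generalized_solution (R : realType) (H : R) (f : R -> R) (c h0 : R)
    : Prop :=
  0 <= h0 <= H /\
  exists fl fr : R,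
    [/\ f h @[h --> within `[0, H] h0^'-] --> fl,
        limf_einf (EFin \o f) (within `[0, H] h0^') = fl%:E &
        fl <= c] /\
    [/\ f h @[h --> within `[0, H] h0^'+] --> fr,
        limf_esup (EFin \o f) (within `[0, H] h0^') = fr%:E &
        c <= fr].

(* Main.v *)
Require Import Defs.
From mathcomp Require Import fingroup perm lra.

(** Write [At h = U diag(rho k * x k h) V^T] and [w = U^T u].  In the bases given
    by the columns of [U] and [V] everything is diagonal, and the residual splits
    as
      beta(h)^2 = mu^2 + sum_(k <= rank A) (1 - theta (x k h))^2 * (w k)^2
    ([residual_regularized_sqr]).  Since [theta (x k h)] starts at 1 and decreases
    in [h], the right-hand side is nondecreasing in [h], and for a fixed [t > 0]
    the coefficients [1 - theta (x k t)] are positive.  The assumption that the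
    residual of [ubar] is smaller than its norm says that some coordinate [w k]
    of [ubar] with [k <= rank A] is nonzero, and this coordinate of the data
    [u d] stays away from 0.  So for small [d] the value of beta^2 at [t] already
    exceeds [d^2 + mu^2], which forces every generalized solution to be at
    most [t].  Hence [h d] tends to 0 from the right ([step_cvg0]).

    Consequently [x k (h d)] tends to 1 for every [k <= rank A].  For small [d]
    no diagonal entry vanishes, so [At (h d)] has the rank of [A]; its nonzero
    singular values are the entries [rho k * x k (h d)], possibly out of order,
    and the largest and the smallest of them tend to [rho 1] and [rho (rank A)]
    ([nu_s_cvg]).  So the condition number tends to [rho 1 / rho (rank A)].  The
    claimed equivalent has the same nonzero limit, because its correction factor
    [1 - h d * (a (rank A) - a 1)] tends to 1; this proves the equivalence.  The
    correction factor is smaller than 1 as soon as [h d > 0] and [rank A > 1],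
    which gives the strict inequality.

    Singular values and pseudoinverses are introduced as arbitrary solutions of
    their defining conditions, so one needs that solutions exist and are unique
    ([svd_exists], [rdiag_orthogonal_entries], [mp_inv_rdiag]). *)

Set Implicit Arguments.
Unset Strict Implicit.
Unset Printing Implicit Defensive.
Local Open Scope classical_set_scope.
Local Open Scope ring_scope.

(** * Orthogonal and rectangular diagonal matrices *)

Lemma fnorm_cV (R : realType) m (v : 'cV[R]_m) :
  fnorm v ^+ 2 = \sum_i v i 0 ^+ 2.
Proof.
rewrite /fnorm sqr_sqrtr; first by apply: eq_bigr => i _; rewrite big_ord1.
by apply: sumr_ge0 => i _; apply: sumr_ge0 => j _; exact: sqr_ge0.
Qed.

Lemma fnorm_ge0 (R : realType) m n (A : 'M[R]_(m, n)) : 0 <= fnorm A.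
Proof. exact: sqrtr_ge0. Qed.

Lemma orthogonal_tr (R : realType) m (U : 'M[R]_m) :
  orthogonal U -> orthogonal U^T.
Proof. by case=> ? ?; split; rewrite trmxK. Qed.

Lemma orthogonal_mul (R : realType) m (U W : 'M[R]_m) :
  orthogonal U -> orthogonal W -> orthogonal (U *m W).
Proof.
move=> [U1 U2] [W1 W2]; split; rewrite trmx_mul mulmxA.
  by rewrite -(mulmxA U) W1 mulmx1.
by rewrite -(mulmxA W^T) U2 mulmx1.
Qed.

Lemma orthogonal_unitmx (R : realType) m (U : 'M[R]_m) :
  orthogonal U -> U \in unitmx.
Proof. by case=> /mulmx1_unit []. Qed.

Lemma orthogonal_perm_mx (R : realType) m (p : 'S_m) :
  orthogonal (perm_mx p : 'M[R]_m).
Proof. by split; rewrite tr_perm_mx -perm_mxM ?mulgV ?mulVg perm_mx1. Qed.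

Lemma fnorm_orthogonal (R : realType) m (U : 'M[R]_m) (v : 'cV[R]_m) :
  orthogonal U -> fnorm (U *m v) = fnorm v.
Proof.
move=> [_ UU]; have sq (w : 'cV[R]_m) : fnorm w ^+ 2 = (w^T *m w) 0 0.
  by rewrite fnorm_cV mxE; apply: eq_bigr => i _; rewrite mxE expr2.
apply/eqP; rewrite -(@eqrXn2 _ 2%N) ?fnorm_ge0 // !sq trmx_mul mulmxA.
by rewrite -(mulmxA v^T) UU mulmx1.
Qed.

Lemma rdiag_mul (R : realType) m n p r (d e : nat -> R) : (r <= n)%N ->
  rdiag m n r d *m rdiag n p r e = rdiag m p r (fun k => d k * e k).
Proof.
move=> rn; apply/matrixP => i j; rewrite !mxE.
have [ir|ri] := ltnP i r; last first.
  by rewrite andbF big1 // => k _; rewrite !mxE ltnNge ri andbF mul0r.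
rewrite andbT (bigD1 (Ordinal (leq_trans ir rn))) //= !mxE /= eqxx ir andbT.
rewrite big1 ?addr0; first by rewrite andbT; case: ifP; rewrite ?mulr0.
by move=> k /eqP ki; rewrite !mxE; case: eqP => [ik|]; rewrite /= ?mul0r //;
  case: ki; apply: val_inj.
Qed.

Lemma rdiag_tr (R : realType) m n r (d : nat -> R) :
  (rdiag m n r d)^T = rdiag n m r d.
Proof.
apply/matrixP => i j; rewrite !mxE eq_sym.
by case: (@eqP nat (i : nat) j) => //= ->.
Qed.

Lemma eq_rdiag (R : realType) m n r (d e : nat -> R) :
  (forall k, (1 <= k)%N -> (k <= r)%N -> d k = e k) ->
  rdiag m n r d = rdiag m n r e.
Proof.
move=> de; apply/matrixP => i j; rewrite !mxE.
by case: ifP => // /andP[_ ir]; rewrite de.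
Qed.

(** Padding the diagonal with ones makes the left factor invertible as soon as
    the entries of [d] are nonzero, so ranks are read off [pid_mx]. *)
Lemma rdiag_pid (R : realType) m n r (d : nat -> R) :
  rdiag m n r d = diag_mx (\row_i (if (i < r)%N then d i.+1 else 1)) *m pid_mx r.
Proof.
apply/matrixP => i j; rewrite mul_diag_mx !mxE.
by case: eqP => _ /=; case: (i < r)%N; rewrite /= ?mulr1 ?mulr0.
Qed.

Lemma rank_rdiag_le (R : realType) m n r (d : nat -> R) :
  (r <= m)%N -> (r <= n)%N -> (\rank (rdiag m n r d) <= r)%N.
Proof.
move=> rm rn; rewrite rdiag_pid (leq_trans (mxrankM_maxr _ _)) //.
by rewrite rank_pid_mx.
Qed.

Lemma rank_rdiag (R : realType) m n r (d : nat -> R) :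
  (r <= m)%N -> (r <= n)%N ->
  (forall k, (1 <= k)%N -> (k <= r)%N -> d k != 0) ->
  \rank (rdiag m n r d) = r.
Proof.
move=> rm rn d0; rewrite rdiag_pid eqmxMfull ?rank_pid_mx //.
rewrite row_full_unit unitmxE det_diag unitfE; apply/prodf_neq0 => i _.
by rewrite mxE; case: ifP => [ir|_]; rewrite ?d0 ?oner_neq0.
Qed.

Lemma rank_orthogonal (R : realType) m n (U : 'M[R]_m) (V : 'M[R]_n)
    (D : 'M[R]_(m, n)) :
  orthogonal U -> orthogonal V -> \rank (U *m D *m V^T) = \rank D.
Proof.
move=> oU oV.
rewrite mxrankMfree ?row_free_unit ?orthogonal_unitmx //; last exact: orthogonal_tr.
by rewrite eqmxMfull // row_full_unit orthogonal_unitmx.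
Qed.

Lemma svd_antitone (R : realType) m n (A : 'M[R]_(m, n)) U V s :
  is_svd A U V s -> forall j k, (1 <= j)%N -> (j <= k)%N -> (k <= \rank A)%N ->
  s k <= s j.
Proof.
move=> [_ _ _ dec _] j k j1 /subnKC <-.
elim: (k - j)%N => [|i IH]; rewrite ?addn0 // addnS => le.
by apply: (le_trans _ (IH (ltnW le))); apply: dec => //; rewrite (leq_trans j1) ?leq_addr.
Qed.

(** A vanishing entry would make the last one vanish by monotonicity; the
    diagonal matrix could then be truncated and its rank would drop. *)
Lemma svd_gt0 (R : realType) m n (A : 'M[R]_(m, n)) U V s :
  is_svd A U V s -> forall k, (1 <= k)%N -> (k <= \rank A)%N -> 0 < s k.
Proof.
move=> svdA k k1 kr; have [oU oV s0 _ defA] := svdA.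
have r1 := leq_trans k1 kr.
apply: (lt_le_trans _ (svd_antitone svdA k1 kr (leqnn _))).
rewrite lt_def s0 // andbT; apply/eqP => sr0.
have /eqP := rank_orthogonal (rdiag m n (\rank A) s) oU oV; rewrite -defA.
suff -> : rdiag m n (\rank A) s = rdiag m n (\rank A).-1 s.
  have le : ((\rank A).-1 < \rank A)%N by rewrite prednK.
  rewrite gtn_eqF // (leq_ltn_trans (rank_rdiag_le _ _ _)) // ltnW //.
    by rewrite (leq_trans le) ?rank_leq_row.
  by rewrite (leq_trans le) ?rank_leq_col.
apply/matrixP => i j; rewrite !mxE -[(i < _.-1)%N]ltnS prednK //.
by case: eqP => //= _; case: (ltngtP i.+1 (\rank A)) => // ->.
Qed.

(** * Existence and uniqueness of singular values *)

(** The common Gram matrix [B *m B^T] is diagonalized by both [U] and [U'], so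
    [Q = U'^T *m U] intertwines the two diagonal matrices of squares.  A nonzero
    entry of [Q] in column [k], which exists as [Q] is orthogonal, equates
    [s k] with an entry of [t].  The positivity of [s k] rules out the
    zero-padded part of the second diagonal. *)
Lemma rdiag_orthogonal_entries (R : realType) m n r
    (U U' : 'M[R]_m) (V V' : 'M[R]_n) (s t : nat -> R) :
  orthogonal U -> orthogonal U' -> orthogonal V -> orthogonal V' ->
  (r <= m)%N -> (r <= n)%N ->
  (forall k, (1 <= k)%N -> (k <= r)%N -> 0 < s k) ->
  (forall k, (1 <= k)%N -> (k <= r)%N -> 0 < t k) ->
  U *m rdiag m n r s *m V^T = U' *m rdiag m n r t *m V'^T ->
  forall k, (1 <= k)%N -> (k <= r)%N ->
  exists j, [/\ (1 <= j)%N, (j <= r)%N & s k = t j].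
Proof.
move=> oU oU' [_ VV] [_ VV'] rm rn s0 t0 eqB [//|k] _ kr.
pose Q := U'^T *m U.
have oQ : orthogonal Q by apply: orthogonal_mul => //; exact: orthogonal_tr.
have gram (W : 'M[R]_m) (Z : 'M[R]_n) d : Z^T *m Z = 1%:M ->
    (W *m rdiag m n r d *m Z^T) *m (W *m rdiag m n r d *m Z^T)^T =
    W *m rdiag m m r (fun i => d i * d i) *m W^T.
  move=> ZZ; rewrite !trmx_mul trmxK !mulmxA -(mulmxA _ Z^T) ZZ mulmx1.
  by rewrite -(mulmxA W) rdiag_tr rdiag_mul.
have QD : rdiag m m r (fun i => t i * t i) *m Q =
          Q *m rdiag m m r (fun i => s i * s i).
  have := gram U V s VV; rewrite eqB gram // => e.
  have := congr1 (fun M => U'^T *m M *m U) e.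
  case: oU oU' => _ UU [_ UU']; rewrite /Q !mulmxA UU' mul1mx => ->.
  by rewrite -!mulmxA UU mulmx1.
clearbody Q; pose k' := Ordinal (leq_trans kr rm).
have [j Qj] : exists j, Q j k' != 0.
  apply/existsP; rewrite -negb_forall; apply/negP => /forallP Q0.
  case: oQ => _ /matrixP /(_ k' k'); rewrite !mxE eqxx big1 => [/eqP|i _].
    by rewrite eq_sym oner_eq0.
  by rewrite (eqP (Q0 i)) mulr0.
have diagl (d : nat -> R) : (rdiag m m r d *m Q) j k' =
    (if (j < r)%N then d j.+1 else 0) * Q j k'.
  rewrite mxE (bigD1 j) //= mxE eqxx big1 ?addr0 // => i /negPf ij.
  by rewrite mxE eq_sym -[(_ == _ :> nat)]/(i == j) ij mul0r.
have diagr (d : nat -> R) : (Q *m rdiag m m r d) j k' = Q j k' * d k.+1.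
  rewrite mxE (bigD1 k') //= mxE eqxx /= kr big1 ?addr0 // => i /negPf ik.
  by rewrite mxE -[(_ == _ :> nat)]/(i == k') ik mulr0.
have := congr1 (fun M : 'M[R]_m => M j k') QD.
rewrite diagl diagr mulrC => /(mulfI Qj).
have sk := s0 k.+1 isT kr.
case: ifPn => [jr|_ /esym /eqP]; last by rewrite mulf_eq0 orbb gt_eqF.
rewrite -!expr2 => /eqP; rewrite eqrXn2 // ?ltW ?t0 // => /eqP <-.
by exists j.+1.
Qed.

(** The sorting permutation is taken on all of [nat], as the identity beyond
    [r], so that it restricts both to row and to column indices. *)
Lemma nat_sort_decreasing (R : realType) r (d : nat -> R) :
  exists f : nat -> nat, [/\ injective f, (forall i, (f i < r)%N = (i < r)%N),
    (forall i, (r <= i)%N -> f i = i) &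
    (forall i, (i.+1 < r)%N -> d (f i.+1) <= d (f i))].
Proof.
(* The default value [i] of [nth i s i] makes the map the identity beyond [r]. *)
pose e i j := d j <= d i; pose s := sort e (iota 0 r).
have sz : size s = r by rewrite size_sort size_iota.
have out i : (r <= i)%N -> nth i s i = i by move=> ?; rewrite nth_default ?sz.
have lt i : (nth i s i < r)%N = (i < r)%N.
  have [ir|ri] := ltnP i r; last by rewrite out // ltnNge ri.
  have : nth i s i \in s by rewrite mem_nth ?sz.
  by rewrite mem_sort mem_iota.
exists (fun i => nth i s i); split => //.
- move=> i j eij; have := lt i; rewrite eij lt.
  have [ir|ri] := ltnP i r; last by move=> /negbT; rewrite -leqNgt => /out <-; rewrite -eij out.
  move=> jr; apply/eqP; rewrite -(@nth_uniq _ i s) ?sz ?sort_uniq ?iota_uniq //.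
  by rewrite [nth i s i]eij; apply/eqP; apply: set_nth_default; rewrite sz.
- move=> i ir; have /(sortedP i) : sorted e s.
    by apply: sort_sorted => a b; exact: le_total.
  by move=> /(_ i); rewrite sz ir (@set_nth_default _ s i.+1 i i.+1) ?sz // => /(_ isT).
Qed.

Lemma ord_perm_ext m (f : nat -> nat) :
  injective f -> (forall i, (i < m)%N -> (f i < m)%N) ->
  exists p : {perm 'I_m}, forall i, p i = f i :> nat.
Proof.
move=> finj fm; pose g (i : 'I_m) := Ordinal (fm i (ltn_ord i)).
have ginj : injective g by move=> i j /(congr1 val) /= /finj /val_inj.
by exists (perm ginj) => i; rewrite permE.
Qed.

(** A product with unsorted positive entries becomes a singular value
    decomposition once the sorting permutation is absorbed in [U] and [V]. *)
Lemma svd_exists (R : realType) m n r (U : 'M[R]_m) (V : 'M[R]_n) (d : nat -> R) :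
  orthogonal U -> orthogonal V -> (r <= m)%N -> (r <= n)%N ->
  (forall k, (1 <= k)%N -> (k <= r)%N -> 0 < d k) ->
  exists s U' V', is_svd (U *m rdiag m n r d *m V^T) U' V' s.
Proof.
move=> oU oV rm rn d0.
have rk : \rank (U *m rdiag m n r d *m V^T) = r.
  by rewrite rank_orthogonal // rank_rdiag // => k k1 kr; rewrite gt_eqF ?d0.
have [f [finj flt fout fdec]] := nat_sort_decreasing r (fun i => d i.+1).
have fbound N : (r <= N)%N -> forall i, (i < N)%N -> (f i < N)%N.
  move=> rN i iN; have [ir|/fout -> //] := ltnP i r.
  by apply: leq_trans rN; rewrite flt.
have [p pf] := ord_perm_ext finj (fbound m rm).
have [q qf] := ord_perm_ext finj (fbound n rn).
exists (fun k => d (f k.-1).+1), (U *m (perm_mx p)^T), (V *m (perm_mx q)^T).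
split.
- by apply: orthogonal_mul => //; apply: orthogonal_tr; exact: orthogonal_perm_mx.
- by apply: orthogonal_mul => //; apply: orthogonal_tr; exact: orthogonal_perm_mx.
- by rewrite rk => -[//|k] _ kr; rewrite ltW // d0 // flt.
- by rewrite rk => -[//|k] _ kr; apply: fdec.
rewrite rk.
have -> : rdiag m n r (fun k => d (f k.-1).+1) =
    perm_mx p *m rdiag m n r d *m (perm_mx q)^T.
  rewrite tr_perm_mx -col_permE -row_permE; apply/matrixP => i j.
  by rewrite !mxE pf qf flt (inj_eq finj).
have [_ pp] := orthogonal_perm_mx R p; have [_ qq] := orthogonal_perm_mx R q.
rewrite trmx_mul trmxK !mulmxA -(mulmxA U _ (perm_mx p)) pp mulmx1.
by rewrite -(mulmxA _ _ (perm_mx q)) qq mulmx1.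
Qed.

(** Whatever decomposition [singvals] selects, it has the same set of entries as
    [d], in decreasing order: its first and last entries are the maximum and the
    minimum of [d]. *)
Lemma singvals_extreme (R : realType) m n r (U : 'M[R]_m) (V : 'M[R]_n) d :
  orthogonal U -> orthogonal V -> (0 < r)%N -> (r <= m)%N -> (r <= n)%N ->
  (forall k, (1 <= k)%N -> (k <= r)%N -> 0 < d k) ->
  let B := U *m rdiag m n r d *m V^T in
  [/\ \rank B = r,
      exists i, [/\ (1 <= i)%N, (i <= r)%N, singvals B 1%N = d i &
        forall k, (1 <= k)%N -> (k <= r)%N -> d k <= d i] &
      exists j, [/\ (1 <= j)%N, (j <= r)%N, singvals B r = d j &
        forall k, (1 <= k)%N -> (k <= r)%N -> d j <= d k]].
Proof.
move=> oU oV r0 rm rn d0 B.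
have rk : \rank B = r.
  by rewrite rank_orthogonal // rank_rdiag // => k k1 kr; rewrite gt_eqF ?d0.
have : exists s, [set s | exists U V, is_svd B U V s] s.
  have [s [U' [V' svdB]]] := svd_exists oU oV rm rn d0.
  by exists s, U', V'.
move=> /(xgetPex (fun=> 0)); rewrite -/(singvals B).
set s := singvals B => -[U' [V' svdB]].
have := svd_gt0 svdB; have := svd_antitone svdB; rewrite rk => sdec s0.
have [oU' oV' _ _] := svdB; rewrite rk => eqB.
have sd := rdiag_orthogonal_entries oU' oU oV' oV rm rn s0 d0 (esym eqB).
have ds := rdiag_orthogonal_entries oU oU' oV oV' rm rn d0 s0 eqB.
split => //.
  have [i [i1 ir si]] := sd _ (leqnn 1) r0; exists i; split => // k k1 kr.
  by have [j [j1 jr ->]] := ds _ k1 kr; rewrite -si sdec.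
have [i [i1 ir si]] := sd _ r0 (leqnn r); exists i; split => // k k1 kr.
by have [j [j1 jr ->]] := ds _ k1 kr; rewrite -si sdec.
Qed.

Lemma nu_s_svd (R : realType) m n (A : 'M[R]_(m, n)) U V s :
  is_svd A U V s -> (0 < \rank A)%N -> nu_s A = s 1%N / s (\rank A).
Proof.
move=> svdA r0; have [oU oV _ _ defA] := svdA.
have anti := svd_antitone svdA.
have := singvals_extreme oU oV r0 (rank_leq_row _) (rank_leq_col _) (svd_gt0 svdA).
rewrite /= -defA => -[_ [i [i1 ir s1 maxi]] [j [j1 jr sr minj]]].
rewrite /nu_s s1 sr; congr (_ / _); apply/eqP; rewrite eq_le; apply/andP; split.
- exact: anti.
- exact: maxi.
- exact: minj.
- exact: anti.
Qed.

(** * Pseudoinverses and residuals *)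

(** [A X = A Y A X] is a product of two symmetric matrices; transposing it gives
    [A X A Y = A Y].  Likewise [X A = Y A], whence [X = X A X = Y A Y = Y]. *)
Lemma pseudoinverse_unique (R : realType) m n (A : 'M[R]_(m, n)) X Y :
  is_pseudoinverse A X -> is_pseudoinverse A Y -> X = Y.
Proof.
move=> [AXA XAX sAX sXA] [AYA YAY sAY sYA].
have AXY : A *m X = A *m Y by rewrite -sAX -{1}AYA -(mulmxA (A *m Y)) trmx_mul sAX sAY mulmxA AXA.
have XAY : X *m A = Y *m A by rewrite -sXA -{1}AYA -!mulmxA mulmxA trmx_mul sXA sYA -mulmxA (mulmxA A) AXA.
by rewrite -XAX XAY -mulmxA AXY mulmxA.
Qed.

Lemma theta_mul (R : realType) (p y : R) : 0 < p -> theta (p * y) = p^-1 * theta y.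
Proof.
by move=> p0; rewrite /theta pmulr_rgt0 //; case: ifP; rewrite ?mulr0 // invfM.
Qed.

Lemma mul_theta (R : realType) (y : R) : 0 <= y -> y * theta y * y = y.
Proof.
rewrite /theta le_eqVlt => /orP[/eqP <-|y0]; first by rewrite mulr0.
by rewrite y0 divff ?mul1r ?gt_eqF.
Qed.

Lemma theta_mul_theta (R : realType) (y : R) : theta y * y * theta y = theta y.
Proof.
by rewrite /theta; case: ifP => [y0|]; rewrite ?mulr0 // mulVf ?mul1r ?gt_eqF.
Qed.

Lemma mp_inv_rdiag (R : realType) m n r (U : 'M[R]_m) (V : 'M[R]_n) d :
  orthogonal U -> orthogonal V -> (r <= m)%N -> (r <= n)%N ->
  (forall k, (1 <= k)%N -> (k <= r)%N -> 0 <= d k) ->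
  mp_inv (U *m rdiag m n r d *m V^T) = V *m rdiag n m r (fun k => theta (d k)) *m U^T.
Proof.
move=> [_ UU] [_ VV] rm rn d0.
set B := _ *m V^T; set X := RHS.
have BX : B *m X = U *m rdiag m m r (fun k => d k * theta (d k)) *m U^T.
  by rewrite /B /X !mulmxA -(mulmxA _ V^T) VV mulmx1 -(mulmxA U) rdiag_mul.
have XB : X *m B = V *m rdiag n n r (fun k => theta (d k) * d k) *m V^T.
  by rewrite /B /X !mulmxA -(mulmxA _ U^T) UU mulmx1 -(mulmxA V) rdiag_mul.
have psX : is_pseudoinverse B X.
  split; last 2 first.
  - by rewrite BX !trmx_mul trmxK rdiag_tr mulmxA.
  - by rewrite XB !trmx_mul trmxK rdiag_tr mulmxA.
  - rewrite BX /B !mulmxA -(mulmxA _ U^T) UU mulmx1 -(mulmxA U) rdiag_mul //.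
    by congr (_ *m _ *m _); apply: eq_rdiag => k k1 kr; rewrite mul_theta ?d0.
  - rewrite XB /X !mulmxA -(mulmxA _ V^T) VV mulmx1 -(mulmxA V) rdiag_mul //.
    by congr (_ *m _ *m _); apply: eq_rdiag => k _ _; rewrite theta_mul_theta.
apply: (pseudoinverse_unique _ psX).
by rewrite /mp_inv; apply: (xgetPex 0); exists X.
Qed.

(** In the basis of the columns of [U] the operator [A B^+ - 1] is diagonal, with
    entry [-1] beyond [r]. *)
Lemma residual_rdiag (R : realType) m n r (U : 'M[R]_m) (V : 'M[R]_n) rho d
    (v : 'cV[R]_m) :
  orthogonal U -> orthogonal V -> (r <= m)%N -> (r <= n)%N ->
  (forall k, (1 <= k)%N -> (k <= r)%N -> 0 <= d k) ->
  residual (U *m rdiag m n r rho *m V^T) (U *m rdiag m n r d *m V^T) v ^+ 2 =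
  \sum_(i < m) ((if (i < r)%N then rho i.+1 * theta (d i.+1) else 0) - 1) ^+ 2
                * (U^T *m v) i 0 ^+ 2.
Proof.
move=> oU oV rm rn d0; rewrite /residual mp_inv_rdiag //.
have [[UU' UU] [_ VV]] := (oU, oV).
set D := fun k => rho k * theta (d k).
rewrite !mulmxA -(mulmxA _ V^T) VV mulmx1 -(mulmxA U) rdiag_mul // -/D.
have -> : U *m rdiag m m r D *m U^T *m v - v =
          U *m (rdiag m m r D *m (U^T *m v) - U^T *m v).
  by rewrite mulmxBr !mulmxA UU' mul1mx.
rewrite fnorm_orthogonal // fnorm_cV; apply: eq_bigr => i _.
rewrite -exprMn !mxE; congr (_ ^+ 2); rewrite mulrBl mul1r; congr (_ - _).
rewrite (bigD1 i) //= [rdiag _ _ _ _ _ _]mxE eqxx big1 ?addr0 ?mxE // => j /negPf ij.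
by rewrite [rdiag _ _ _ _ _ _]mxE eq_sym -[(_ == _ :> nat)]/(j == i) ij mul0r.
Qed.

Lemma coord_le_fnorm (R : realType) m (v : 'cV[R]_m) i : `|v i 0| <= fnorm v.
Proof.
rewrite -(@ler_pXn2r _ 2%N) ?nnegrE ?fnorm_ge0 // fnorm_cV real_normK ?num_real //.
by rewrite (bigD1 i) //= lerDl; apply: sumr_ge0 => j _; exact: sqr_ge0.
Qed.

(** * Limits *)

(** If [e < h0], then monotonicity makes the left limit at [h0] at least [f e > c],
    whereas a generalized solution requires it to be at most [c]. *)
Lemma generalized_solution_le (R : realType) (H : R) (f : R -> R) c h0 e :
  {in `[0, H] &, {homo f : s t / s <= t}} -> 0 <= e -> c < f e ->
  generalized_solution H f c h0 -> h0 <= e.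
Proof.
move=> fmono e0 cfe [/andP[h00 h0H] [fl [_ [[cvl _ flc] _]]]].
rewrite leNgt; apply/negP => eh0.
have lt_near : \forall t \near h0^'-, t \in `[0, H] -> f t < f e.
  exact: (@cvgr_lt _ _ _ _ f fl cvl _ (le_lt_trans flc cfe)).
suff : \forall t \near h0^'-, False by move=> /filter_ex[].
near=> t.
have et : e < t by near: t; exact: nbhs_left_gt.
have th0 : t < h0 by near: t; exact: nbhs_left_lt.
have tH : t \in `[0, H].
  by rewrite in_itv /= (le_trans e0 (ltW et)) (le_trans (ltW th0)).
have eH : e \in `[0, H] by rewrite in_itv /= e0 (le_trans (ltW eh0)).
have : f t < f e by move: tH; near: t.
by rewrite ltNge fmono // ltW.
Unshelve. all: by end_near.
Qed.

Lemma equiv_of_cvg (R : realType) (T : Type) (F : filter_on T) (f g : T -> R) (l : R) :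
  l != 0 -> f x @[x --> F] --> l -> g x @[x --> F] --> l -> f ~_F g.
Proof.
move=> l0 fl gl; apply/eqaddoP => e e0.
have el : 0 < e * `|l| / 2 by rewrite divr_gt0 ?mulr_gt0 ?normr_gt0.
have d0 : `|(f \- g) x| @[x --> F] --> (0 : R).
  by rewrite -(normr0 R) -(subrr l); apply: cvg_norm; exact: cvgB.
have gn : `|g x| @[x --> F] --> `|l| by exact: cvg_norm.
have l2 : `|l| / 2 < `|l| by rewrite ltr_pdivrMr // mulr_natr mulr2n ltrDl normr_gt0.
near=> x.
apply: (@le_trans _ _ (e * `|l| / 2)); first by near: x; exact: (cvgr_le _ d0).
by rewrite -mulrA ler_pM2l //; near: x; exact: (cvgr_ge _ gn).
Unshelve. all: by end_near.
Qed.

Lemma cvg_relative_error (R : realType) (T : Type) (F : set_system T) {FF : Filter F}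
    (f : T -> R) (l : R) :
  0 < l ->
  (forall e, 0 < e -> e < 1 -> \forall x \near F, l * (1 - e) <= f x <= l * (1 + e)) ->
  f x @[x --> F] --> l.
Proof.
move=> l0 fl; apply/cvgrPdist_le => e e0.
pose e' := Num.min (e / l) (1 / 2).
have e'0 : 0 < e' by rewrite lt_min !divr_gt0.
have e'1 : e' < 1 by rewrite gt_min; apply/orP; right; lra.
have le_e : l * e' <= e by rewrite mulrC -ler_pdivlMr // ge_min lexx.
near=> x.
have /andP[lo hi] : l * (1 - e') <= f x <= l * (1 + e') by near: x; exact: fl.
by rewrite ler_norml; apply/andP; split; lra.
Unshelve. all: by end_near.
Qed.

(** * The condition number under a relative perturbation of singular values *)

(** The factors [y k] may reorder the entries [rho k * y k t].  Their maximum is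
    nevertheless squeezed: it is at least the entry of index 1, and at most
    [rho 1 * (1 + e)] when all factors are within [e] of 1; similarly for the
    minimum and the index [r]. *)
Lemma nu_s_cvg (R : realType) (T : Type) (F : set_system T) {FF : Filter F}
    m n r (U : 'M[R]_m) (V : 'M[R]_n) (rho : nat -> R) (y : nat -> T -> R) :
  orthogonal U -> orthogonal V -> (0 < r)%N -> (r <= m)%N -> (r <= n)%N ->
  (forall k, (1 <= k)%N -> (k <= r)%N -> 0 < rho k) ->
  (forall j k, (1 <= j)%N -> (j <= k)%N -> (k <= r)%N -> rho k <= rho j) ->
  (forall k, (1 <= k)%N -> (k <= r)%N -> y k t @[t --> F] --> (1 : R)) ->
  let B t := U *m rdiag m n r (fun k => rho k * y k t) *m V^T in
  (\forall t \near F, \rank (B t) = r) /\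
  nu_s (B t) @[t --> F] --> rho 1%N / rho r.
Proof.
move=> oU oV r0 rm rn rho0 rho_anti y1 B.
have near_y e : 0 < e -> \forall t \near F,
    forall k, (1 <= k)%N -> (k <= r)%N -> 1 - e <= y k t <= 1 + e.
  move=> e0; have : \forall t \near F, forall i : 'I_r, `|1 - y i.+1 t| <= e.
    by apply: filter_forall => i; exact: (cvgr_dist_le _ _ (y1 i.+1 isT (ltn_ord i))).
  apply: filterS => t yt [//|k] _ kr; have := yt (Ordinal kr); rewrite /= ler_norml.
  by move=> /andP[? ?]; apply/andP; split; lra.
have ext t e : e < 1 ->
    (forall k, (1 <= k)%N -> (k <= r)%N -> 1 - e <= y k t <= 1 + e) ->
    [/\ \rank (B t) = r,
        rho 1%N * (1 - e) <= singvals (B t) 1%N <= rho 1%N * (1 + e) &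
        rho r * (1 - e) <= singvals (B t) r <= rho r * (1 + e)].
  move=> e1 yt.
  have ge k : (1 <= k)%N -> (k <= r)%N -> rho k * (1 - e) <= rho k * y k t.
    by move=> k1 kr; have /andP[lo _] := yt k k1 kr; rewrite ler_pM2l // rho0.
  have le k : (1 <= k)%N -> (k <= r)%N -> rho k * y k t <= rho k * (1 + e).
    by move=> k1 kr; have /andP[_ hi] := yt k k1 kr; rewrite ler_pM2l // rho0.
  have e_ge0 : 0 <= e by have /andP[] := yt _ (leqnn 1) r0; lra.
  have d0 k : (1 <= k)%N -> (k <= r)%N -> 0 < rho k * y k t.
    by move=> k1 kr; apply: (lt_le_trans _ (ge k k1 kr)); rewrite mulr_gt0 ?rho0 ?subr_gt0.
  have [rk [i [i1 ir -> maxi]] [j [j1 jr -> minj]]] := singvals_extreme oU oV r0 rm rn d0.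
  split => //; apply/andP; split.
  - by apply: (le_trans (ge _ (leqnn 1) r0)); exact: maxi.
  - by apply: (le_trans (le _ i1 ir)); rewrite ler_wpM2r ?rho_anti //; lra.
  - by apply: (le_trans _ (ge _ j1 jr)); rewrite ler_wpM2r ?rho_anti //; lra.
  - by apply: (le_trans _ (le _ r0 (leqnn r))); exact: minj.
have rankB : \forall t \near F, \rank (B t) = r.
  have h2 : (0 : R) < 1 / 2 by lra.
  by apply: filterS (near_y _ h2) => t /ext -[] //; lra.
split => //.
have near_sv k : k = 1%N \/ k = r -> singvals (B t) k @[t --> F] --> rho k.
  move=> k1r; apply: cvg_relative_error; first by case: k1r => ->; rewrite rho0.
  move=> e e0 e1; apply: filterS (near_y e e0) => t /ext -[] // _.
  by case: k1r => ->.
have cvgq : singvals (B t) 1%N / singvals (B t) r @[t --> F] --> rho 1%N / rho r.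
  apply: cvgM; first by apply: near_sv; left.
  by apply: cvgV; [rewrite gt_eqF ?rho0 | apply: near_sv; right].
apply: cvg_trans cvgq; apply: near_eq_cvg.
by apply: filterS rankB => t rk; rewrite /nu_s rk.
Qed.

(** * The discrepancy near a zero step *)

Lemma admissible_theta_le1 (R : realType) (M : nat) (H : R) (x : nat -> R -> R) k t :
  admissible_family M H x -> (1 <= k)%N -> (k <= M)%N -> 0 <= t -> t <= H ->
  theta (x k t) <= 1.
Proof.
move=> adm k1 kM t0 tH; have [_ _ [_ x0 _] _ anti] := adm k k1 kM.
by apply: le_trans (anti 0 t (lexx _) t0 tH) _; rewrite x0 /theta ltr01 invr1.
Qed.

Lemma admissible_theta_lt1 (R : realType) (M : nat) (H : R) (x : nat -> R -> R) k t :
  admissible_family M H x -> (1 <= k)%N -> (k <= M)%N -> 0 < t -> t <= H ->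
  theta (x k t) < 1.
Proof.
move=> adm k1 kM t0 tH; have [_ [c xc] _ _ _] := adm k k1 kM.
have [->|[x1 _]] := xc t t0 tH; rewrite /theta; first by rewrite ltxx ltr01.
by rewrite (lt_trans ltr01 x1) invf_lt1 // (lt_trans ltr01 x1).
Qed.

Lemma theta_ge0 (R : realType) (y : R) : 0 <= theta y.
Proof. by rewrite /theta; case: ifP => // y0; rewrite invr_ge0 ltW. Qed.

Section Discrepancy.
Context (R : realType) (m n r : nat) (U : 'M[R]_m) (V : 'M[R]_n) (rho : nat -> R).
Context (H : R) (x : nat -> R -> R).
Context (oU : orthogonal U) (oV : orthogonal V) (rm : (r <= m)%N) (rn : (r <= n)%N)
  (rho0 : forall k, (1 <= k)%N -> (k <= r)%N -> 0 < rho k)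
  (adm : admissible_family (minn m n) H x).
Let A := U *m rdiag m n r rho *m V^T.
Let w (v : 'cV[R]_m) (i : 'I_m) := (U^T *m v) i 0.

Let le_min k : (k <= r)%N -> (k <= minn m n)%N.
Proof. by move=> kr; rewrite leq_min !(leq_trans kr). Qed.

Lemma residual_self_sqr v :
  residual A A v ^+ 2 = \sum_(i < m | (r <= i)%N) w v i ^+ 2.
Proof.
rewrite residual_rdiag //; last by move=> k k1 kr; rewrite ltW ?rho0.
rewrite [RHS]big_mkcond; apply: eq_bigr => i _; case: ltnP => ir.
  by rewrite /theta rho0 // divff ?gt_eqF ?rho0 // subrr expr0n mul0r.
by rewrite sub0r sqrrN expr1n mul1r.
Qed.

Lemma residual_regularized_sqr v t : 0 <= t -> t <= H ->
  residual A (Atilde r U V rho x t) v ^+ 2 =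
  residual A A v ^+ 2 +
  \sum_(i < m | (i < r)%N) (1 - theta (x i.+1 t)) ^+ 2 * w v i ^+ 2.
Proof.
move=> t0 tH; rewrite [X in _ = X + _]residual_self_sqr [LHS]residual_rdiag //; last first.
  move=> k k1 kr; have [x0 _ _ _ _] := adm k1 (le_min kr).
  by rewrite mulr_ge0 ?x0 // ltW ?rho0.
rewrite [X in _ = X + _]big_mkcond [X in _ = _ + X]big_mkcond -big_split.
apply: eq_bigr => i _ /=; case: ltnP => ir.
  by rewrite theta_mul ?rho0 // (mulrA (rho _)) divff ?gt_eqF ?rho0 // mul1r add0r -sqrrN opprB.
by rewrite sub0r sqrrN expr1n mul1r addr0.
Qed.

Lemma residual_regularized_mono v :
  {in `[0, H] &, {homo (fun t => residual A (Atilde r U V rho x t) v ^+ 2)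
                    : s t / s <= t}}.
Proof.
move=> s t; rewrite !in_itv /= => /andP[s0 sH] /andP[t0 tH] st.
rewrite [leLHS](residual_regularized_sqr v s0 sH).
rewrite [leRHS](residual_regularized_sqr v t0 tH) lerD2l; apply: ler_sum => i ir.
have [_ _ _ _ anti] := adm (isT : (1 <= i.+1)%N) (le_min ir).
rewrite ler_wpM2r ?sqr_ge0 // ler_sqr ?nnegrE ?subr_ge0;
  rewrite ?(admissible_theta_le1 adm) ?le_min //.
by rewrite lerD2l lerN2 anti.
Qed.

(** By [residual_self_sqr], if all the coordinates below [r] vanished then the
    residual would contain the whole norm of [v]. *)
Lemma residual_lt_fnorm_coord v :
  residual A A v < fnorm v -> exists2 i : 'I_m, (i < r)%N & w v i != 0.
Proof.
move=> lt; suff /existsP[i /andP[? ?]] : [exists i : 'I_m, (i < r)%N && (w v i != 0)].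
  by exists i.
apply: contraTT lt; rewrite negb_exists => /forallP w0; rewrite -leNgt.
rewrite -(@ler_pXn2r _ 2%N) ?nnegrE ?fnorm_ge0 //.
rewrite residual_self_sqr -(fnorm_orthogonal v (orthogonal_tr oU)) fnorm_cV.
rewrite [leRHS]big_mkcond; apply: ler_sum => i _; case: ltnP => // ir.
by have := w0 i; rewrite ir /= negbK => /eqP; rewrite /w => ->; rewrite expr0n.
Qed.

(** A single coordinate [w i] suffices: it moves by at most [d] from [ubar] to
    [v], and [g = 1 - theta (x i.+1 t)] is at most 1, so
    [g * (|w| - d) >= g * |w| - d > d]; this is where the factor 2 comes from. *)
Lemma discrepancy_lt (ubar v : 'cV[R]_m) (d t : R) (i : 'I_m) :
  0 < d -> 0 < t -> t <= H -> (i < r)%N -> fnorm (v - ubar) <= d ->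
  2 * d < (1 - theta (x i.+1 t)) * `|w ubar i| ->
  d ^+ 2 + residual A A v ^+ 2 < residual A (Atilde r U V rho x t) v ^+ 2.
Proof.
move=> d0 t0 tH ir vd dlt; rewrite [ltRHS](residual_regularized_sqr v (ltW t0) tH) addrC ltrD2l.
rewrite (bigD1 i) //=; apply: ltr_wpDr.
  by apply: sumr_ge0 => j _; rewrite mulr_ge0 ?sqr_ge0.
have th1 := admissible_theta_lt1 adm (isT : (1 <= i.+1)%N) (le_min ir) t0 tH.
have th0 := theta_ge0 (x i.+1 t).
have wd : `|w ubar i| - d <= `|w v i|.
  rewrite lerBlDl -lerBlDr (le_trans (lerB_dist _ _)) //.
  have -> : w ubar i - w v i = (U^T *m (ubar - v)) i 0 by rewrite mulmxBr mxE [X in _ = _ + X]mxE.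
  apply: le_trans (coord_le_fnorm _ _) _.
  rewrite fnorm_orthogonal; last exact: orthogonal_tr.
  suff -> : fnorm (ubar - v) = fnorm (v - ubar) by [].
  rewrite -opprB /fnorm; congr (Num.sqrt _); apply: eq_bigr => a _.
  by apply: eq_bigr => b _; rewrite mxE sqrrN.
have g0 : 0 < 1 - theta (x i.+1 t) by rewrite subr_gt0.
have lt_prod : d < (1 - theta (x i.+1 t)) * `|w v i|.
  apply: (lt_le_trans _ (ler_wpM2l (ltW g0) wd)).
  have : (1 - theta (x i.+1 t)) * d <= d by rewrite ger_pMl // lerBlDr lerDl.
  by rewrite mulrBr; lra.
rewrite -[w v i ^+ 2]real_normK ?num_real // -exprMn.
by rewrite ltr_pXn2r // nnegrE ltW // (lt_trans d0).
Qed.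

End Discrepancy.

(** For small [d] a fixed [t] overshoots the level [d^2 + mu^2], so the
    generalized solution [h d > 0] is at most [t]; and [t] is arbitrarily small. *)
Lemma step_cvg0 (R : realType) (m n r : nat) (U : 'M[R]_m) (V : 'M[R]_n)
    (rho : nat -> R) (H : R) (x : nat -> R -> R)
    (ubar : 'cV[R]_m) (u : R -> 'cV[R]_m) (h : R -> R) :
  orthogonal U -> orthogonal V -> (r <= m)%N -> (r <= n)%N ->
  (forall k, (1 <= k)%N -> (k <= r)%N -> 0 < rho k) ->
  0 < H -> admissible_family (minn m n) H x ->
  (forall d, 0 < d -> fnorm (u d - ubar) <= d) ->
  let A := U *m rdiag m n r rho *m V^T in
  residual A A ubar < fnorm ubar ->
  (\forall d \near (0 : R)^'+, 0 < h d /\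
     generalized_solution H (fun t => residual A (Atilde r U V rho x t) (u d) ^+ 2)
       (d ^+ 2 + residual A A (u d) ^+ 2) (h d)) ->
  h d @[d --> (0 : R)^'+] --> (0 : R)^'+.
Proof.
move=> oU oV rm rn rho0 H0 adm ud A /(residual_lt_fnorm_coord oU oV rm rn rho0)[i ir wi].
move=> sol P /= [e /= e0 Pe]; rewrite nbhs_filterE /=.
(* The neighbourhood [P] contains ]0, e[, so it is enough to trap [h d] below a
   point [t < e] of ]0, H]. *)
pose t := Num.min (e / 2) H.
have t0 : 0 < t by rewrite lt_min divr_gt0.
have tH : t <= H by rewrite ge_min lexx orbT.
have te : t < e by rewrite gt_min; apply/orP; left; lra.
have iM : (i.+1 <= minn m n)%N by rewrite leq_min !(leq_trans ir).
have th1 := admissible_theta_lt1 adm (isT : (1 <= i.+1)%N) iM t0 tH.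
have b0 : 0 < (1 - theta (x i.+1 t)) * `|(U^T *m ubar) i 0| / 2.
  by rewrite divr_gt0 ?mulr_gt0 ?subr_gt0 ?normr_gt0.
near=> d.
have d0 : 0 < d by near: d; exact: nbhs_right_gt.
have db : d < (1 - theta (x i.+1 t)) * `|(U^T *m ubar) i 0| / 2.
  by near: d; exact: nbhs_right_lt.
have [h0 gs] : 0 < h d /\ generalized_solution H
    (fun t => residual A (Atilde r U V rho x t) (u d) ^+ 2)
    (d ^+ 2 + residual A A (u d) ^+ 2) (h d) by near: d; exact: sol.
apply: Pe => //=; rewrite sub0r normrN gtr0_norm //; apply: le_lt_trans te.
have db2 : 2 * d < (1 - theta (x i.+1 t)) * `|(U^T *m ubar) i 0|.
  by rewrite mulrC -ltr_pdivlMr.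
have := discrepancy_lt oU oV rm rn rho0 adm d0 t0 tH ir (ud d d0) db2.
have mono := residual_regularized_mono oU oV rm rn rho0 adm (u d).
by move=> lt; exact: (generalized_solution_le mono (ltW t0) lt gs).
Unshelve. all: by end_near.
Qed.

(** * Asymptotics of the condition number *)

Theorem theorem3 (R : realType) (m n : nat)
  (A : 'M[R]_(m, n)) (ubar : 'cV[R]_m) (u : R -> 'cV[R]_m)
  (U : 'M[R]_m) (V : 'M[R]_n) (rho : nat -> R)
  (H : R) (x : nat -> R -> R) (a : nat -> R) (h : R -> R) :
  let rbar := \rank A in
  let At := Atilde rbar U V rho x in
  let beta d t := residual A (At t) (u d) in
  let mu d := residual A A (u d) in
  let r d := \rank (At (h d)) in
  let X d := rho 1%N / rho (r d) * (1 - h d * (a (r d) - a 1%N)) in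
  (0 < m)%N -> (0 < n)%N ->
  fnorm A <> 0 -> fnorm ubar <> 0 ->
  (forall d, 0 < d -> fnorm (u d - ubar) <= d) ->
  is_svd A U V rho ->
  0 < H ->
  admissible_family (minn m n) H x ->
  (exists2 d0 : R, 0 < d0 & forall d, 0 < d -> d < d0 ->
     forall v : 'cV[R]_m, fnorm (v - ubar) <= d -> residual A A v < fnorm v) ->
  (\forall d \near (0 : R)^'+, 0 < h d /\
     generalized_solution H (fun t => beta d t ^+ 2) (d ^+ 2 + mu d ^+ 2) (h d)) ->
  (forall k, (1 <= k)%N -> (k <= rbar)%N ->
     x k ~_((0 : R)^'+) (fun t => 1 + a k * t)) ->
  (forall j k, (1 <= j)%N -> (j < k)%N -> (k <= rbar)%N -> a j < a k) ->
  (fun d => nu_s (At (h d))) ~_((0 : R)^'+) X /\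
  ((1 < rbar)%N -> \forall d \near (0 : R)^'+, X d < nu_s A).
Proof.
move=> rbar At beta mu r X _ _ A0 _ ud svdA H0 adm [d0 d00 reg] sol _ a_incr.
have [oU oV _ _ defA] := svdA.
have rho0 := svd_gt0 svdA; have rho_anti := svd_antitone svdA.
have rm : (rbar <= m)%N by exact: rank_leq_row.
have rn : (rbar <= n)%N by exact: rank_leq_col.
have r0 : (0 < rbar)%N.
  rewrite lt0n mxrank_eq0; apply/eqP => A_eq0; apply: A0.
  rewrite A_eq0 /fnorm big1 ?sqrtr0 // => i _.
  by rewrite big1 // => j _; rewrite mxE expr0n.
have h_cvg : h d @[d --> (0 : R)^'+] --> (0 : R)^'+.
  have res0 : residual A A ubar < fnorm ubar.
    (* The vector [ubar] itself is an admissible datum for [d = d0 / 2]. *)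
    apply: (reg (d0 / 2)); rewrite ?divr_gt0 //; first by lra.
    rewrite subrr /fnorm big1 ?sqrtr0 ?divr_ge0 ?ltW // => i _.
    by rewrite big1 // => j _; rewrite mxE expr0n.
  have := @step_cvg0 R m n rbar U V rho H x ubar u h oU oV rm rn rho0 H0 adm ud.
  by rewrite /= -defA; exact.
have h0 : h d @[d --> (0 : R)^'+] --> (0 : R).
  by apply: (cvg_trans h_cvg); exact: cvg_within.
have y1 k : (1 <= k)%N -> (k <= rbar)%N -> x k (h d) @[d --> (0 : R)^'+] --> (1 : R).
  move=> k1 kr; have kM : (k <= minn m n)%N by rewrite leq_min !(leq_trans kr).
  by have [_ _ [x1 _ _] _ _] := adm k k1 kM; exact: cvg_comp h_cvg x1.
have [rankAt nu_cvg] := nu_s_cvg oU oV r0 rm rn rho0 rho_anti y1.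
have r_eq : \forall d \near (0 : R)^'+, r d = rbar by exact: rankAt.
have q0 : 0 < rho 1%N / rho rbar by rewrite divr_gt0 ?rho0.
have X_cvg : X d @[d --> (0 : R)^'+] --> rho 1%N / rho rbar.
  have lim : rho 1%N / rho rbar * (1 - h d * (a rbar - a 1%N)) @[d --> (0 : R)^'+]
             --> rho 1%N / rho rbar * (1 - 0 * (a rbar - a 1%N)).
    by apply: cvgMr; apply: cvgB; [exact: cvg_cst | apply: cvgMl].
  rewrite mul0r subr0 mulr1 in lim.
  apply: cvg_trans lim; apply: near_eq_cvg.
  by apply: filterS r_eq => d rd; rewrite /X rd.
split; first by apply: equiv_of_cvg nu_cvg X_cvg; rewrite gt_eqF.
move=> r1; rewrite (nu_s_svd svdA r0).
apply: filterS2 r_eq sol => d rd [hd _].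
rewrite /X rd gtr_pMr // gtrBl mulr_gt0 // subr_gt0.
exact: a_incr.
Qed.
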